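(* Let $\mathcal{P}_2$ be the set of pairs $(m,n)$ of relatively prime positive integers of opposite parity with $1<m/n<2$. Let $\{(A_{m,n},B_{m,n},C_{m,n})\}_{(m,n)\in\mathcal{P}_2}$ be a family of triples of connected graphs such that for all $(m,n)\in\mathcal{P}_2$ $$Z(A_{m,n})=m^2-n^2,\qquad Z(B_{m,n})=2mn,\qquad Z(C_{m,n})=m^2+n^2.$$ Suppose the family has a common symmetric kernel $(A^{(2)},B^{(2)},C^{(2)})$; that is, $A^{(2)},B^{(2)},C^{(2)}$ are graphs, each with a left and a right base point, and for every $(m,n)\in\mathcal{P}_2$ there is a graph $G_{m,n}$ with a base point such that $A_{m,n}=G_{m,n}\vee A^{(2)}\vee G_{m,n}$, $B_{m,n}=G_{m,n}\vee B^{(2)}\vee G_{m,n}$ and $C_{m,n}=G_{m,n}\vee C^{(2)}\vee G_{m,n}$. Then $$(A^{(2)},B^{(2)},C^{(2)})=(C(\ddot3),\,C(\dot1,2,\dot1),\,C(\dot1,1,1,\dot1))$$ as triples of graphs with left and right base points.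
   Context: Graphs are finite, undirected, without loops or multiple edges; equality of graphs (with base points) means isomorphism (respecting base points). The Hosoya index $Z(G)$ is the number of matchings of $G$ (sets of pairwise vertex-disjoint edges, including the empty set). For positive integers $a_1,\dots,a_d$, the caterpillar $C(a_1,\dots,a_d)$ has vertices $(i,j)$ with $1\le i\le d$, $1\le j\le a_i$, and edges $\{(i,1),(i,j)\}$ for $1<j\le a_i$ and $\{(i,1),(i+1,1)\}$ for $1\le i<d$. Dots mark base points: in $C(a_1,\dots,\dot a_l,\dots,\dot a_r,\dots,a_d)$ with $l<r$ the left base point is $(l,1)$ and the right base point is $(r,1)$; a double dot $\ddot a_l$ means that $(l,1)$ is both the left and the right base point. If $G$ is a graph with a base point $g$ and $S$ is a graph with left base point $l$ and right base point $r$ (possibly $l=r$), then $G\vee S\vee G$ is the graph obtained from the disjoint union of $S$ and two copies of $G$ by identifying the base point $g$ of the first copy with $l$ and the base point $g$ of the second copy with $r$ (if $l=r$ all three vertices are identified). *)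

(* Defs.v *)
From mathcomp Require Import all_boot.

Set Implicit Arguments.
Unset Strict Implicit.
Unset Printing Implicit Defensive.

Record graph := Graph {
  vertex :> finType;
  adj : rel vertex;
  adj_sym : symmetric adj;
  adj_irrefl : irreflexive adj }.

Record pointed_graph := PointedGraph {
  pgraph :> graph;
  base : pgraph }.

(* The two base points are allowed to coincide. *)
Record bipointed_graph := BipointedGraph {
  bgraph :> graph;
  lbase : bgraph;
  rbase : bgraph }.

Definition is_iso (G H : graph) (f : G -> H) : Prop :=
  bijective f /\ forall x y : G, adj (f x) (f y) = adj x y.

Definition graph_iso (G H : graph) : Prop := exists f : G -> H, is_iso f.

Definition bipointed_iso (S T : bipointed_graph) : Prop :=
  exists f : S -> T,
    [/\ is_iso f, f (lbase S) = lbase T & f (rbase S) = rbase T].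

Definition connected (G : graph) : Prop :=
  0 < #|G| /\ forall x y : G, connect (@adj G) x y.

Definition edges (G : graph) : {set {set G}} :=
  [set e | [exists x, exists y, adj x y && (e == [set x; y])]].

Definition matchings (G : graph) : {set {set {set G}}} :=
  [set M : {set {set G}} | (M \subset edges G) && trivIset M].

Definition hosoya (G : graph) : nat := #|matchings G|.

Section Glue.
Variables (G : pointed_graph) (S : bipointed_graph).

(* The disjoint union of S and two copies of G, modulo the identification of
   base points: every class has exactly one representative that lies in S or
   is a non-base vertex of one of the two copies of G. *)
Definition glue_vertex : finType :=
  (S + ({x : G | x != base G} + {x : G | x != base G}))%type.

Definition glue_mid (s : S) : glue_vertex := inl s.

Definition glue_left (x : G) : glue_vertex :=
  if insub x is Some y then inr (inl y) else inl (lbase S).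

Definition glue_right (x : G) : glue_vertex :=
  if insub x is Some y then inr (inr y) else inl (rbase S).

Definition image_adj (H : graph) (f : H -> glue_vertex) : rel glue_vertex :=
  fun u v => [exists x, exists y, [&& adj x y, f x == u & f y == v]].

Definition glue_adj : rel glue_vertex := fun u v =>
  [|| image_adj glue_mid u v, image_adj glue_left u v
    | image_adj glue_right u v].

Lemma image_adj_sym (H : graph) (f : H -> glue_vertex) :
  symmetric (image_adj f).
Proof.
move=> u v; apply/idP/idP => /existsP[x /existsP[y /and3P[xy fx fy]]];
by apply/existsP; exists y; apply/existsP; exists x; rewrite adj_sym xy fx fy.
Qed.

Lemma image_adj_irrefl (H : graph) (f : H -> glue_vertex) :
  injective f -> irreflexive (image_adj f).
Proof.
move=> f_inj u; apply/negbTE/negP.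
case/existsP=> x /existsP[y /and3P[xy /eqP fx /eqP fy]].
have exy : x = y by apply: f_inj; rewrite fx fy.
by rewrite exy adj_irrefl in xy.
Qed.

Lemma glue_left_inj : injective glue_left.
Proof.
move=> x y; rewrite /glue_left.
case: insubP => [u _ ux|/negPn/eqP ->]; case: insubP => [v _ vy|/negPn/eqP ->] //.
by case=> uv; rewrite -ux -vy uv.
Qed.

Lemma glue_right_inj : injective glue_right.
Proof.
move=> x y; rewrite /glue_right.
case: insubP => [u _ ux|/negPn/eqP ->]; case: insubP => [v _ vy|/negPn/eqP ->] //.
by case=> uv; rewrite -ux -vy uv.
Qed.

Lemma glue_adj_sym : symmetric glue_adj.
Proof. by move=> u v; rewrite /glue_adj !(image_adj_sym _ u). Qed.

Lemma glue_adj_irrefl : irreflexive glue_adj.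
Proof.
move=> u; rewrite /glue_adj (image_adj_irrefl glue_left_inj).
by rewrite (image_adj_irrefl glue_right_inj) image_adj_irrefl // => x y [].
Qed.

Definition glue : graph := Graph glue_adj_sym glue_adj_irrefl.

End Glue.

Section Caterpillar.
Variable a : seq nat.

(* Indices are shifted to start at 0: the vertex written (i, j) with
   1 <= i <= d and 1 <= j <= a_i is here the pair (i - 1, j - 1). *)
Definition cat_vertex : finType := {i : 'I_(size a) & 'I_(nth 0 a i)}.

Definition cat_arc : rel cat_vertex := fun u v =>
  [&& tag u == tag v, tagged u == 0 :> nat & 0 < tagged v]
  || [&& tag v == (tag u).+1 :> nat, tagged u == 0 :> nat
       & tagged v == 0 :> nat].

Definition cat_adj : rel cat_vertex := fun u v => cat_arc u v || cat_arc v u.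

Lemma cat_adj_sym : symmetric cat_adj.
Proof. by move=> u v; rewrite /cat_adj orbC. Qed.

Lemma cat_adj_irrefl : irreflexive cat_adj.
Proof.
move=> u; apply/negbTE; rewrite /cat_adj orbb /cat_arc eqxx /=.
rewrite (ltn_eqF (ltnSn _)) orbF.
by case: (nat_of_ord _).
Qed.

Definition caterpillar : graph := Graph cat_adj_sym cat_adj_irrefl.

Definition cat_base (a_gt0 : all (leq 1) a) (i : 'I_(size a)) : caterpillar :=
  Tagged (fun i : 'I_(size a) => 'I_(nth 0 a i))
    (Ordinal (all_nthP 0 a_gt0 i (ltn_ord i))).

Definition dotted_caterpillar (a_gt0 : all (leq 1) a) (l r : 'I_(size a)) :
    bipointed_graph :=
  BipointedGraph (cat_base a_gt0 l) (cat_base a_gt0 r).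

End Caterpillar.

Definition P2 (m n : nat) : Prop :=
  [/\ 0 < m, 0 < n, coprime m n, odd m != odd n & n < m < 2 * n].

Definition common_symmetric_kernel (A B C : nat -> nat -> graph)
    (A2 B2 C2 : bipointed_graph) : Prop :=
  forall m n, P2 m n -> exists G : pointed_graph,
    [/\ graph_iso (A m n) (glue G A2), graph_iso (B m n) (glue G B2)
      & graph_iso (C m n) (glue G C2)].

(* Main.v *)
(* Let y = Z(G - g) and x = Z(G) - y.  Then Z(G v S v G) is the value at (x, y)
   of the quadratic form
     Z(S) y^2 + (Z(S - l) + Z(S - r)) x y + Z(S - l - r) x^2,
   where the last term is absent when l = r.  Along the pairs (n + 1, n) the form
   of A grows only linearly, so its x^2 term vanishes and the base points of A
   coincide; that form is then divisible by y, and the prime values 5, 7, 11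
   force y = 1.  This determines all three forms, up to one case refuted by
   (m, n) = (7, 4).  The kernels are connected, being retracts of the glued
   graphs, and the coefficients of its form then determine each kernel. *)

Require Import Defs.
From mathcomp Require Import all_boot zify.

Set Implicit Arguments.
Unset Strict Implicit.
Unset Printing Implicit Defensive.

(** * Matchings inside a set of vertices *)

Section InducedMatchings.
Variable G : graph.
Implicit Types (D : {set G}) (u v w : G) (M : {set {set G}}).

Definition matchings_in D : {set {set {set G}}} :=
  [set M in matchings G | cover M \subset D].

Definition nmatch D : nat := #|matchings_in D|.

Lemma edgesP (e : {set G}) :
  reflect (exists x y, adj x y /\ e = [set x; y]) (e \in edges G).
Proof.
rewrite inE; apply: (iffP existsP) => [[x /existsP[y /andP[xy /eqP->]]]|].
  by exists x, y.
by case=> x [y [xy ->]]; exists x; apply/existsP; exists y; rewrite xy eqxx.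
Qed.

Lemma edge_set2 v w : ([set v; w] \in edges G) = adj v w.
Proof.
apply/edgesP/idP => [[x [y [xy E]]]|vw]; last by exists v, w.
have /set2P hv : v \in [set x; y] by rewrite -E set21.
have /set2P hw : w \in [set x; y] by rewrite -E set22.
have /set2P hx : x \in [set v; w] by rewrite E set21.
have /set2P hy : y \in [set v; w] by rewrite E set22.
have xy' : x <> y by move=> E'; rewrite E' adj_irrefl in xy.
case: hv => Ev; case: hw => Ew; rewrite ?Ev ?Ew // in hx hy *.
- by case: hy => yx; case: xy'.
- by rewrite adj_sym.
- by case: hx => yx; case: xy'.
Qed.

Lemma matchings_inP D M :
  reflect [/\ M \subset edges G, trivIset M & cover M \subset D]
          (M \in matchings_in D).
Proof. by rewrite !inE -andbA; apply: and3P. Qed.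

Lemma hosoya_nmatch : hosoya G = nmatch setT.
Proof. by apply: eq_card => M; rewrite [RHS]inE subsetT andbT. Qed.

Lemma edge_mem_matching M v e : M \subset edges G -> e \in M -> v \in e ->
  exists2 w, adj v w & e = [set v; w].
Proof.
move=> /subsetP ME /ME /edgesP[x [y [xy ->]]] /set2P[->|->]; first by exists y.
by exists x; rewrite 1?adj_sym // setUC.
Qed.

(** The edges of a matching are disjoint, so at most one summand is 1. The indicator of being
    covered is written as a sum over partners so that the sums can be exchanged in [nmatchD1]. *)
Lemma matching_partner D M v : M \in matchings_in D ->
  \sum_(w in D | adj v w) ([set v; w] \in M) = (v \in cover M).
Proof.
move=> /matchings_inP[ME /trivIsetP MT MD].
case: (boolP (v \in cover M)) => [/bigcupP[e eM ve]|nv]; last first.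
  apply: big1 => w _; case: (boolP (_ \in M)) => // eM; case/negP: nv.
  by apply/bigcupP; exists [set v; w] => //; rewrite set21.
have [w vw E] := edge_mem_matching ME eM ve; rewrite {}E in eM ve *.
have wD : w \in D.
  by apply: (subsetP MD); apply/bigcupP; exists [set v; w] => //; rewrite set22.
rewrite (bigD1 w) /=; last by rewrite wD.
rewrite eM big1 ?addn0 // => w' /andP[/andP[_ vw'] w'w].
case: (boolP (_ \in M)) => // eM'.
have : [set v; w] != [set v; w'].
  apply: contra w'w => /eqP E; have : w' \in [set v; w] by rewrite E set22.
  by case/set2P => [E'|->//]; rewrite E' adj_irrefl in vw'.
move/(MT _ _ eM eM'); rewrite -setI_eq0 => /eqP/setP/(_ v).
by rewrite !inE eqxx.
Qed.

(** Adding and removing the edge are inverse bijections. *)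
Lemma card_matchings_edge D v w : v \in D -> w \in D -> adj v w ->
  #|[set M in matchings_in D | [set v; w] \in M]| = nmatch (D :\ v :\ w).
Proof.
move=> vD wD vw; set e := [set v; w].
have e0 M : M \in matchings_in (D :\ v :\ w) -> e \notin M.
  case/matchings_inP => _ _ /subsetP MD; apply/negP => eM.
  have /MD : v \in cover M by apply/bigcupP; exists e => //; rewrite set21.
  by rewrite !inE eqxx andbF.
rewrite /nmatch.
have inj : {in matchings_in (D :\ v :\ w) &, injective (fun M => e |: M)}.
  by move=> M N /e0 eM /e0 eN E; rewrite -(setU1K eM) -(setU1K eN) E.
rewrite -(card_in_imset inj); apply: eq_card => M; rewrite inE.
apply/andP/imsetP => [[MD eM]|[N ND ->]]; last first.
  have := e0 N ND; move: ND; rewrite setU11.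
  case/matchings_inP => NE NT ND eN; split=> //; apply/matchings_inP; split.
  - by rewrite subUset sub1set edge_set2 vw.
  - suff dis N' : N' \in N -> [disjoint e & N'].
      apply: (proj1 (trivIsetU1 dis NT _)).
      (* [trivIsetU1] asks that the empty set be absent from [N]; it is, because edges are
         nonempty. *)
      apply/negP => N0; have /edgesP[x [y [_ /setP/(_ x)]]] := subsetP NE _ N0.
    by rewrite !inE eqxx.
    move=> N'N; rewrite -setI_eq0; apply/eqP/setP => x; rewrite !inE.
    apply/negP => /andP[xe xN'].
    have /(subsetP ND) : x \in cover N by apply/bigcupP; exists N'.
    by rewrite !inE; case/orP: xe => /eqP ->; rewrite eqxx /= ?andbF.
  - rewrite /cover bigcup_setU big_set1 subUset; apply/andP; split.
      by apply/subsetP => x; rewrite !inE => /orP[] /eqP->.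
    by apply: (subset_trans ND); rewrite setDDl subsetDl.
exists (M :\ e); last by rewrite setD1K.
case/matchings_inP: MD => ME MT MD; apply/matchings_inP; split.
- by apply: subset_trans ME; apply: subsetDl.
- by apply: trivIsetS MT; apply: subsetDl.
apply/subsetP => x /bigcupP[f]; rewrite !inE => /andP[fe fM] xf.
have xD : x \in D by apply: (subsetP MD); apply/bigcupP; exists f.
have /trivIsetP/(_ _ _ fM eM fe) := MT.
rewrite -setI_eq0 => /eqP/setP/(_ x); rewrite !inE xf xD /= andbT => /negbT.
by rewrite negb_or andbC.
Qed.

(** Matchings are sorted by the partner of [v], if any. This deletion recurrence drives all later
    counts, which thus never handle sets of sets directly. *)
Lemma nmatchD1 D v : v \in D ->
  nmatch D = nmatch (D :\ v)
    + \sum_(w in D | adj v w) nmatch (D :\ v :\ w).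
Proof.
move=> vD.
have -> : nmatch D = \sum_(M in matchings_in D) (v \notin cover M)
    + \sum_(M in matchings_in D) (v \in cover M).
  rewrite -big_split /= /nmatch -sum1_card; apply: eq_bigr => M _.
  by case: (v \in _).
congr (_ + _).
  rewrite -big_mkcondr /= sum1dep_card; apply: eq_card => M.
  by rewrite !inE subsetD1 andbA.
under eq_bigr => M MD do rewrite -(matching_partner _ MD).
rewrite exchange_big /=; apply: eq_bigr => w /andP[wD vw].
by rewrite -card_matchings_edge // -big_mkcondr /= sum1dep_card.
Qed.

Lemma nmatch_gt0 D : 0 < nmatch D.
Proof.
apply/card_gt0P; exists set0; apply/matchings_inP.
by rewrite /cover big_set0 !sub0set; split=> //; apply/trivIsetP => A B; rewrite inE.
Qed.

Lemma nmatch0 : nmatch set0 = 1.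
Proof.
apply/eqP/cards1P; exists set0; apply/setP => M; rewrite in_set1.
apply/matchings_inP/eqP => [[ME _ M0]|->]; last first.
  by rewrite /cover big_set0 !sub0set; split=> //; apply/trivIsetP => A B; rewrite inE.
apply/setP => e; rewrite inE; apply/negP => eM.
have /edgesP[x [y [_ E]]] := subsetP ME _ eM.
have /(subsetP M0) : x \in cover M by apply/bigcupP; exists e; rewrite // E set21.
by rewrite inE.
Qed.

Lemma nmatchD1_le D v : nmatch (D :\ v) <= nmatch D.
Proof.
case: (boolP (v \in D)) => [/nmatchD1 -> | vD]; first exact: leq_addr.
suff -> : D :\ v = D by [].
by apply/setP => x; rewrite !inE; case: eqP => // ->; rewrite (negPf vD).
Qed.

Lemma nmatch_eq1P D :
  reflect {in D &, forall u v, adj u v = false} (nmatch D == 1).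
Proof.
apply: (iffP eqP) => [D1 u v uD vD|].
  apply/negP => uv; move: D1; rewrite (nmatchD1 uD) (bigD1 v) /=; last by rewrite vD.
  have := nmatch_gt0 (D :\ u); have := nmatch_gt0 (D :\ u :\ v); lia.
have [n] := ubnP #|D|; elim: n D => // n IH D Dn D0.
case: (set_0Vmem D) => [->|[v vD]]; first exact: nmatch0.
rewrite (nmatchD1 vD) big1 => [|w /andP[wD]]; last by rewrite D0.
rewrite addn0; apply: IH => [|x y]; first by move: Dn; rewrite (cardsD1 v) vD.
by rewrite !inE => /andP[_ xD] /andP[_ yD]; apply: D0.
Qed.

(** Induction on [D1] with the deletion recurrence: the neighbours of the deleted vertex stay in
    [D1], so every term acquires the factor [nmatch D2]. *)
Lemma nmatchU D1 D2 :
    [disjoint D1 & D2] -> {in D1 & D2, forall u v, adj u v = false} ->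
  nmatch (D1 :|: D2) = nmatch D1 * nmatch D2.
Proof.
have [n] := ubnP #|D1|; elim: n D1 => // n IH D1 D1n dis sep.
case: (set_0Vmem D1) => [->|[v v1]]; first by rewrite set0U nmatch0 mul1n.
have v2 : v \notin D2 by rewrite (disjointFr dis).
have red w : w \in D1 -> (D1 :|: D2) :\ w = (D1 :\ w) :|: D2.
  move=> w1; rewrite setDUl; congr (_ :|: _); apply/setP => x; rewrite !inE.
  by case: eqP => // ->; rewrite (disjointFr dis).
have IHv (E : {set G}) : E \subset D1 :\ v -> nmatch (E :|: D2) = nmatch E * nmatch D2.
  move=> ED; have E1 : E \subset D1 by apply: subset_trans ED (subsetDl _ _).
  apply: IH; last by move=> x y /(subsetP E1); apply: sep.
    by have := subset_leq_card ED; move: D1n; rewrite (cardsD1 v) v1; lia.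
  by apply: disjointWl dis.
rewrite (nmatchD1 v1) mulnDl -IHv // -red // (@nmatchD1 _ v) ?inE ?v1 //.
congr (_ + _); rewrite big_distrl /=.
rewrite (eq_bigl (fun w => (w \in D1) && adj v w)) => [|w]; last first.
  rewrite !inE; case: (boolP (w \in D1)) => //= w1.
  by apply/negP => /andP[w2]; rewrite sep.
apply: eq_bigr => w /andP[w1 vw]; rewrite -IHv; last exact: subsetDl.
congr nmatch; apply/setP => x; rewrite !inE.
case: (x =P w) => [->|] //=; first by rewrite (disjointFr dis).
by case: (x =P v) => [->|] //=; rewrite (negPf v2).
Qed.

(* Both sides count how [v] is matched in [D1 :|: D2]: not at all, inside [D1],
   or inside [D2]; the product on the left makes up for counting the first
   case twice. *)
Lemma nmatch_cut D1 D2 v : D1 :&: D2 = [set v] ->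
    {in D1 :\ v & D2 :\ v, forall x y, adj x y = false} ->
  nmatch (D1 :|: D2) + nmatch (D1 :\ v) * nmatch (D2 :\ v)
    = nmatch (D1 :\ v) * nmatch D2 + nmatch D1 * nmatch (D2 :\ v).
Proof.
move=> I12 sep; have /setIP[v1 v2] : v \in D1 :&: D2 by rewrite I12 set11.
have dis : [disjoint D1 :\ v & D2 :\ v].
  rewrite -setI_eq0; apply/eqP/setP => x; have /setP/(_ x) := I12.
  by rewrite !inE; case: eqP => //= _ ->.
have prod (E1 E2 : {set G}) : E1 \subset D1 :\ v -> E2 \subset D2 :\ v ->
    nmatch (E1 :|: E2) = nmatch E1 * nmatch E2.
  move=> s1 s2; apply: nmatchU; first by apply: disjointWl s1 (disjointWr s2 dis).
  by move=> x y /(subsetP s1) x1 /(subsetP s2); apply: sep.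
have nv w : adj v w -> w != v by apply: contraTneq => ->; rewrite adj_irrefl.
rewrite (@nmatchD1 _ v) ?inE ?v1 //.
rewrite (nmatchD1 v1) (nmatchD1 v2) setDUl prod //.
(* The neighbours of [v] are split by side. The two sides share only [v], so those outside [D1] are
   exactly its neighbours in [D2]. *)
rewrite (bigID (fun w => w \in D1)) /=.
rewrite (eq_bigl (fun w => (w \in D1) && adj v w)) => [|w]; last first.
  by rewrite !inE; case: (w \in D1) => //=; rewrite ?andbF ?andbT.
rewrite [X in _ + (_ + X)](eq_bigl (fun w => (w \in D2) && adj v w)) => [|w]; last first.
  rewrite !inE; case: (boolP (w \in D2)); case: (boolP (w \in D1)) => //= w1 w2;
    rewrite ?andbT ?andbF //; apply/esym/negP => /nv wv.
  by have /setP/(_ w) := I12; rewrite !inE w1 w2 (negPf wv).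
(* Deleting a neighbour of [v] affects one side only, and what remains is a separated union to which
   [prod] applies. *)
have hs (x w : G) (E F : {set G}) : E :&: F \subset [set x] -> w \in E -> w != x ->
    (E :\ x :|: F :\ x) :\ w = E :\ x :\ w :|: F :\ x.
  move=> EF wE wx; apply/setP => y; rewrite !inE; case: (y =P w) => //= ->.
  rewrite wx /=; apply/esym/negP => wF.
  by have := subsetP EF w; rewrite !inE wE wF (negPf wx) => /(_ isT).
under eq_bigr => w /andP[w1 vw].
  rewrite (hs v) ?I12 ?nv // prod ?subsetDl //; over.
under [X in _ + (_ + X)]eq_bigr => w /andP[w2 vw].
  rewrite [X in X :\ w]setUC (hs v) ?(setIC D2) ?I12 ?nv // setUC prod ?subsetDl //; over.
rewrite -big_distrl -big_distrr /=; lia.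
Qed.

End InducedMatchings.

Lemma nmatch_imset (G H : graph) (f : G -> H) (D : {set G}) :
    {in D &, injective f} -> {in D &, forall x y, adj (f x) (f y) = adj x y} ->
  nmatch (f @: D) = nmatch D.
Proof.
have [n] := ubnP #|D|; elim: n D => // n IH D Dn inj hom.
case: (set_0Vmem D) => [->|[v vD]]; first by rewrite imset0 !nmatch0.
have IHv (E : {set G}) : E \subset D :\ v -> nmatch (f @: E) = nmatch E.
  move=> ED; have E1 : E \subset D by apply: subset_trans ED (subsetDl _ _).
  apply: IH => [|x y /(subsetP E1) xD /(subsetP E1)|x y /(subsetP E1) xD /(subsetP E1)].
  - by have := subset_leq_card ED; move: Dn; rewrite (cardsD1 v) vD; lia.
  - exact: inj.
  - exact: hom.
have im (E : {set G}) w : E \subset D -> w \in D -> f @: E :\ f w = f @: (E :\ w).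
  move=> ED wD; apply/setP => y; rewrite in_setD1; apply/andP/imsetP.
    case=> yw /imsetP[x xE E']; exists x => //; rewrite !inE xE andbT.
    by apply: contraNneq yw => <-; rewrite E'.
  case=> x; rewrite !inE => /andP[xw xE] ->; split; last exact: imset_f.
  by apply: contra xw => /eqP /(inj _ _ (subsetP ED _ xE) wD) ->.
rewrite (nmatchD1 vD) (nmatchD1 (imset_f f vD)) im // IHv //; congr (_ + _).
rewrite big_mkcondr /= big_imset //= [RHS]big_mkcondr /=; apply: eq_bigr => w wD.
by rewrite hom // im ?subsetDl // IHv // subsetDl.
Qed.

Lemma hosoya_iso (G H : graph) : graph_iso G H -> hosoya G = hosoya H.
Proof.
case=> f [fb fh]; rewrite !hosoya_nmatch -(@nmatch_imset _ _ f).
- congr nmatch; apply/setP => y; rewrite [RHS]inE; apply/imsetP.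
  by case: fb => g _ gK; exists (g y); rewrite ?gK.
- by move=> x y _ _; apply: bij_inj.
- by move=> x y _ _; apply: fh.
Qed.

(** * Hosoya index and connectedness of the glued graph *)

Lemma imset_setD1 (aT rT : finType) (f : aT -> rT) (D : {set aT}) a :
  injective f -> f @: D :\ f a = f @: (D :\ a).
Proof.
move=> fI; apply/setP => y; rewrite in_setD1; apply/andP/imsetP.
  case=> ya /imsetP[x xD E]; exists x => //; rewrite !inE xD andbT.
  by apply: contraNneq ya => <-; rewrite E.
case=> x; rewrite in_setD1 => /andP[xa xD] ->; split; last exact: imset_f.
by apply: contra xa => /eqP/fI ->.
Qed.

Lemma image_adj_inj (G : pointed_graph) (S : bipointed_graph) (H : graph)
    (f : H -> glue_vertex G S) (x y : H) :
  injective f -> image_adj f (f x) (f y) = adj x y.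
Proof.
move=> fI; apply/existsP/idP => [[a /existsP[b /and3P[ab /eqP/fI <- /eqP/fI <-]]] //|xy].
by exists x; apply/existsP; exists y; rewrite xy !eqxx.
Qed.

(** There are no loops, so an edge needs two distinct preimages. This discards the pieces of
    [glue_adj] in which the preimages of [u] and [v] can only be the same base point, or do not both
    exist. *)
Lemma image_adj_disjoint (G : pointed_graph) (S : bipointed_graph) (H : graph)
    (f : H -> glue_vertex G S) (u v : glue_vertex G S) :
  (forall a b : H, f a = u -> f b = v -> a = b) -> image_adj f u v = false.
Proof.
move=> fE; apply/existsP => [[a /existsP[b /and3P[ab /eqP fa /eqP fb]]]].
by rewrite (fE a b fa fb) adj_irrefl in ab.
Qed.

Section GlueHosoya.
Variables (G : pointed_graph) (S : bipointed_graph).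
Implicit Types (x y : G) (s t : S).

Let T : graph := glue G S.
Let mid (s : S) : T := glue_mid G s.
Let left (x : G) : T := glue_left S x.
Let right (x : G) : T := glue_right S x.

Lemma glue_left_mid x s : left x = mid s -> x = base G /\ s = lbase S.
Proof.
by rewrite /left /glue_left; case: insubP => // /negPn/eqP -> [->].
Qed.

Lemma glue_right_mid x s : right x = mid s -> x = base G /\ s = rbase S.
Proof.
by rewrite /right /glue_right; case: insubP => // /negPn/eqP -> [->].
Qed.

Lemma glue_left_right x y : left x = right y -> x = base G /\ y = base G.
Proof.
rewrite /left /right /glue_left /glue_right.
by case: insubP => // [? _ _|/negPn/eqP ->]; case: insubP => // /negPn/eqP ->.
Qed.

Lemma glue_left_base : left (base G) = mid (lbase S).
Proof. by rewrite /left /glue_left insubF // eqxx. Qed.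

Lemma glue_right_base : right (base G) = mid (rbase S).
Proof. by rewrite /right /glue_right insubF // eqxx. Qed.

Lemma glue_vertexP (u : T) :
  [\/ exists s, u = mid s, exists x, u = left x | exists x, u = right x].
Proof.
case: u => [s|[[x hx]|[x hx]]]; [by apply: Or31; exists s| |].
  by apply: Or32; exists x; rewrite /left /glue_left insubT.
by apply: Or33; exists x; rewrite /right /glue_right insubT.
Qed.

Lemma glue_mid_inj : injective mid. Proof. by move=> s t []. Qed.

Lemma glue_adj_mid s t : adj (mid s) (mid t) = adj s t.
Proof.
rewrite /= /glue_adj image_adj_inj; last exact: glue_mid_inj.
rewrite !image_adj_disjoint ?orbF // => a b.
  by move=> /glue_right_mid[-> _] /glue_right_mid[].
by move=> /glue_left_mid[-> _] /glue_left_mid[].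
Qed.

Lemma glue_adj_left x y : adj (left x) (left y) = adj x y.
Proof.
rewrite /= /glue_adj image_adj_inj; last exact: glue_left_inj.
rewrite !image_adj_disjoint ?orbF // => a b.
  by move=> /esym/glue_left_right[_ ->] /esym/glue_left_right[].
by move=> /esym/glue_left_mid[_ ->] /esym/glue_left_mid[].
Qed.

Lemma glue_adj_right x y : adj (right x) (right y) = adj x y.
Proof.
rewrite /= /glue_adj image_adj_inj; last exact: glue_right_inj.
rewrite !image_adj_disjoint ?orbF // => a b.
  by move=> /glue_left_right[-> _] /glue_left_right[].
by move=> /esym/glue_right_mid[_ ->] /esym/glue_right_mid[].
Qed.

Lemma glue_adj_left_mid x s : x != base G ->
  adj (left x) (mid s) = (s == lbase S) && adj x (base G).
Proof.
move=> xb; case: eqP => [->|sl]; first by rewrite -glue_left_base glue_adj_left.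
rewrite /= /glue_adj !image_adj_disjoint // => a b.
- by move=> /esym/glue_left_right[E _]; rewrite E eqxx in xb.
- by move=> _ /glue_left_mid[_ /sl].
- by move=> /esym/glue_left_mid[E _]; rewrite E eqxx in xb.
Qed.

Lemma glue_adj_right_mid x s : x != base G ->
  adj (right x) (mid s) = (s == rbase S) && adj x (base G).
Proof.
move=> xb; case: eqP => [->|sl]; first by rewrite -glue_right_base glue_adj_right.
rewrite /= /glue_adj !image_adj_disjoint // => a b.
- by move=> _ /glue_right_mid[_ /sl].
- by move=> /glue_left_right[_ E]; rewrite E eqxx in xb.
- by move=> /esym/glue_right_mid[E _]; rewrite E eqxx in xb.
Qed.

Lemma glue_adj_left_right x y : x != base G -> y != base G ->
  adj (left x) (right y) = false.
Proof.
move=> xb yb; rewrite /= /glue_adj !image_adj_disjoint // => a b.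
- by move=> /esym/glue_left_right[E _]; rewrite E eqxx in xb.
- by move=> _ /glue_left_right[_ E]; rewrite E eqxx in yb.
- by move=> /esym/glue_left_mid[E _]; rewrite E eqxx in xb.
Qed.

Lemma nmatch_glue_mid (D : {set S}) : nmatch (mid @: D) = nmatch D.
Proof.
by apply: nmatch_imset => [s t _ _ /glue_mid_inj|s t _ _]; rewrite ?glue_adj_mid.
Qed.

Lemma nmatch_glue_left (D : {set G}) : nmatch (left @: D) = nmatch D.
Proof.
by apply: nmatch_imset => [s t _ _ /glue_left_inj|s t _ _]; rewrite ?glue_adj_left.
Qed.

Lemma nmatch_glue_right (D : {set G}) : nmatch (right @: D) = nmatch D.
Proof.
by apply: nmatch_imset => [s t _ _ /glue_right_inj|s t _ _]; rewrite ?glue_adj_right.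
Qed.

(** These two numbers are the variables $y$ and $x$ of the quadratic form: the matchings of [G] that
    avoid the base point and those that cover it. *)
Definition base_free : nat := nmatch ([set: G] :\ base G).
Definition base_matched : nat := nmatch [set: G] - base_free.

Lemma nmatch_base_split : nmatch [set: G] = base_free + base_matched.
Proof. by rewrite /base_matched subnKC // nmatchD1_le. Qed.

(** If the copy of [G] leaves its base point free, any matching of [D] is allowed; if it covers it,
    the matching of [D] must avoid [rbase S]. Keeping [D] general allows the left base point to be
    deleted beforehand. *)
Lemma nmatch_glue_attach_right (D : {set S}) : rbase S \in D ->
  nmatch (mid @: D :|: right @: setT)
    = base_free * nmatch D + base_matched * nmatch (D :\ rbase S).
Proof.
move=> rD; have := @nmatch_cut T (mid @: D) (right @: setT) (mid (rbase S)).
have -> : right @: setT :\ mid (rbase S) = right @: (setT :\ base G).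
  by rewrite -glue_right_base imset_setD1 //; apply: glue_right_inj.
rewrite imset_setD1; last exact: glue_mid_inj.
rewrite !nmatch_glue_mid !nmatch_glue_right nmatch_base_split -/base_free.
have -> : mid @: D :&: right @: setT = [set mid (rbase S)].
  apply/setP => u; rewrite in_set1; apply/setIP/eqP => [[/imsetP[s _ ->]]|->].
    by move=> /imsetP[x _ /esym/glue_right_mid[_ ->]].
  by rewrite imset_f // -glue_right_base imset_f.
move=> /(_ erefl) cut; suff /cut : {in mid @: (D :\ rbase S) & right @: (setT :\ base G),
    forall u v, adj u v = false} by lia.
move=> _ _ /imsetP[s sD ->] /imsetP[x xD ->]; move: sD xD; rewrite !inE andbT.
by move=> /andP[/negPf sr _] xb; rewrite adj_sym glue_adj_right_mid // sr.
Qed.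

(** This coefficient counts the case where both copies cover their base points. When these are
    identified the case is impossible, whence the value 0 instead of a count on $S - l$. *)
Definition quad_coef : nat :=
  if lbase S == rbase S then 0 else nmatch ([set: S] :\ lbase S :\ rbase S).

Lemma hosoya_glue :
  hosoya (glue G S) = base_free ^ 2 * nmatch [set: S]
    + base_matched * base_free
      * (nmatch ([set: S] :\ lbase S) + nmatch ([set: S] :\ rbase S))
    + base_matched ^ 2 * quad_coef.
Proof.
rewrite hosoya_nmatch -/T.
have -> : [set: T] = left @: setT :|: (mid @: setT :|: right @: setT).
  apply/setP => u; rewrite inE; apply/esym; rewrite !in_setU.
  by case: (glue_vertexP u) => [[s ->]|[x ->]|[x ->]]; rewrite imset_f ?orbT.
have := @nmatch_cut T (left @: setT) (mid @: setT :|: right @: setT) (mid (lbase S)).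
have -> : left @: setT :&: (mid @: setT :|: right @: setT) = [set mid (lbase S)].
  apply/setP => u; rewrite in_set1; apply/setIP/eqP => [[/imsetP[x _ ->]]|->].
    case/setUP => /imsetP[y _]; first by move=> E; case/glue_left_mid: (E) => _ <-.
    by case/glue_left_right => -> _; rewrite glue_left_base.
  by rewrite in_setU imset_f // -glue_left_base imset_f.
move=> /(_ erefl) cut; have {cut} := cut _.
have -> : left @: setT :\ mid (lbase S) = left @: (setT :\ base G).
  by rewrite -glue_left_base imset_setD1 //; apply: glue_left_inj.
rewrite !nmatch_glue_left nmatch_base_split -/base_free nmatch_glue_attach_right ?inE //.
(* [w] counts the matchings of [S] with the right copy that avoid the left base point. If the base
   points coincide, this deletion separates [S] from the copy and gives a product; otherwise the
   attachment lemma applies to [S] without [lbase S]. *)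
set w := nmatch ((mid @: _ :|: _) :\ _).
have -> : w = base_free * nmatch ([set: S] :\ lbase S) + base_matched * quad_coef.
  rewrite /w /quad_coef setDUl imset_setD1; last exact: glue_mid_inj.
  case: eqP => [lr|lr].
    rewrite lr -glue_right_base imset_setD1; last exact: glue_right_inj.
    rewrite nmatchU ?nmatch_glue_mid ?nmatch_glue_right; first by rewrite -/base_free; lia.
      rewrite -setI_eq0; apply/eqP/setP => u; rewrite [RHS]inE; apply/negP.
      case/setIP => /imsetP[s sD ->] /imsetP[x _ /esym/glue_right_mid[_ E]].
      by move: sD; rewrite E ?lr !inE eqxx.
    move=> _ _ /imsetP[s sD ->] /imsetP[x xD ->]; move: sD xD; rewrite !inE !andbT.
    by move=> /negPf sr xb; rewrite adj_sym glue_adj_right_mid // sr.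
  rewrite -nmatch_glue_attach_right; last by rewrite !inE andbT; apply/eqP/nesym.
  congr nmatch; congr (_ :|: _); apply/setP => u; rewrite in_setD1.
  case: eqP => // ->; apply/esym/imsetP => -[x _ /esym/glue_right_mid[_ /lr]] //.
suff sep : {in left @: (setT :\ base G)
    & (mid @: setT :|: right @: setT) :\ mid (lbase S), forall u v, adj u v = false}.
  by move=> /(_ sep); lia.
move=> _ v /imsetP[x /setD1P[xb _] ->] /setD1P[vl].
case/setUP => /imsetP[y _ Ev]; rewrite {}Ev in vl *.
  suff yl : y == lbase S = false by rewrite glue_adj_left_mid // yl.
  by apply: contraNF vl => /eqP ->.
case: (y =P base G) => [Ey|/eqP yb]; last exact: glue_adj_left_right.
rewrite Ey glue_right_base glue_adj_left_mid //.
suff -> : rbase S == lbase S = false by [].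
by apply: contraNF vl => /eqP <-; rewrite Ey glue_right_base.
Qed.

(** Each copy of [G] collapses onto its base point. Edges may collapse to a vertex, hence the
    alternative in [glue_retract_adj] and in [connected_quotient]. *)
Definition glue_retract (u : T) : S :=
  match u with
  | inl s => s
  | inr (inl _) => lbase S
  | inr (inr _) => rbase S
  end.

Lemma glue_retract_left x : glue_retract (left x) = lbase S.
Proof. by rewrite /left /glue_left; case: insubP. Qed.

Lemma glue_retract_right x : glue_retract (right x) = rbase S.
Proof. by rewrite /right /glue_right; case: insubP. Qed.

Lemma glue_retract_adj (u v : T) : adj u v ->
  glue_retract u = glue_retract v \/ adj (glue_retract u) (glue_retract v).
Proof.
case/or3P => /existsP[a /existsP[b /and3P[ab /eqP <- /eqP <-]]].
- by right.
- by left; rewrite !glue_retract_left.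
- by left; rewrite !glue_retract_right.
Qed.

End GlueHosoya.

Lemma connected_quotient (G H : graph) (f : G -> H) :
    (forall y, exists x, f x = y) ->
    (forall x y, adj x y -> f x = f y \/ adj (f x) (f y)) ->
  connected G -> connected H.
Proof.
move=> surj hom [/card_gt0P[x0 _] conn]; split.
  by apply/card_gt0P; exists (f x0).
move=> u v; have [x <-] := surj u; have [y <-] := surj v.
have /connectP[p xp ->] := conn x y; elim: p x xp => //= z p IH x /andP[xz zp].
apply: connect_trans (IH z zp); case: (hom _ _ xz) => [->|/connect1] //.
Qed.

Lemma connected_kernel (H : graph) (G : pointed_graph) (S : bipointed_graph) :
  graph_iso H (glue G S) -> connected H -> connected S.
Proof.
case=> f [[g fK gK] fh] /(connected_quotient (f := f)) conn.
apply: (connected_quotient (f := @glue_retract G S)).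
- by move=> s; exists (glue_mid G s).
- exact: glue_retract_adj.
- by apply: conn => [y|x y xy]; [exists (g y) | right; rewrite fh].
Qed.

(** This serves to show that an explicit list of vertices exhausts a connected graph. *)
Lemma connected_closed (G : graph) (X : {set G}) x : connected G -> x \in X ->
  (forall y z, adj y z -> y \in X -> z \in X) -> forall y, y \in X.
Proof.
move=> [_ conn] xX cl y; have /connectP[p xp ->] := conn x y.
by elim: p x xX xp => //= z p IH x xX /andP[xz]; apply: IH (cl _ _ xz xX).
Qed.

(** * Small connected graphs with prescribed matching numbers *)

Lemma setD11C (T : finType) (D : {set T}) p q : D :\ p :\ q = D :\ q :\ p.
Proof. by rewrite !setDDl setUC. Qed.

Section SmallGraphs.
Variable G : graph.
Implicit Types (D : {set G}) (p q u v w x y : G).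

(** The terms of the deletion recurrence at [v] are positive and sum to 1, so there is exactly one
    of them. *)
Lemma nmatch_pendant D v : v \in D -> nmatch D = (nmatch (D :\ v)).+1 ->
  exists w, [/\ w \in D, adj v w, nmatch (D :\ v :\ w) = 1
    & forall y, y \in D -> adj v y -> y = w].
Proof.
move=> vD; rewrite (nmatchD1 vD) -addn1 => /addnI sum1.
case: (pickP [pred w in D | adj v w]) => [w /= wP|none]; last first.
  by rewrite big_pred0 // in sum1.
have := nmatch_gt0 (D :\ v :\ w); move: sum1; rewrite (bigD1 w) //=.
case E1: (nmatch _) => [|[|k]] // [] /eqP; rewrite sum_nat_eq0 => /forall_inP rest _.
case/andP: wP => wD vw; exists w; split=> // y yD vy; apply/eqP/negPn/negP => yw.
have := rest y; rewrite yD vy yw => /(_ isT) /eqP y0.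
by have := nmatch_gt0 (D :\ v :\ y); rewrite y0.
Qed.

(** The two matchings are the empty one and one edge. Deleting an end of that edge leaves a single
    matching, so that end is pendant and no further edge exists. *)
Lemma nmatch_eq2 D : nmatch D = 2 -> exists u v, [/\ u \in D, v \in D, adj u v
  & forall x y, x \in D -> y \in D -> adj x y ->
      x = u /\ y = v \/ x = v /\ y = u].
Proof.
move=> D2; case: (pickP [pred e : G * G | [&& e.1 \in D, e.2 \in D & adj e.1 e.2]]).
  case=> u v /= /and3P[uD vD uv]; exists u, v; split=> //.
  have Du : nmatch (D :\ u) = 1.
    move: D2; rewrite (nmatchD1 uD) (bigD1 v) /=; last by rewrite vD.
    have := nmatch_gt0 (D :\ u); have := nmatch_gt0 (D :\ u :\ v); lia.
  have [|w [_ _ _ uw]] := nmatch_pendant uD; first by rewrite D2 Du.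
  move=> x y xD yD xy; case: (x =P u) xy => [-> uy|/eqP xu xy].
    by left; split=> //; rewrite (uw v vD uv) (uw y yD uy).
  case: (y =P u) xy => [-> xu'|/eqP yu].
    by right; split=> //; rewrite adj_sym in xu'; rewrite (uw v vD uv) (uw x xD xu').
  by move/eqP/nmatch_eq1P: Du => ->; rewrite ?inE ?xu ?yu.
move=> none; have /nmatch_eq1P/eqP : {in D &, forall u v, adj u v = false}.
  by move=> u v uD vD; have := none (u, v); rewrite /= uD vD.
by rewrite D2.
Qed.

Lemma connected_neighbor p q : connected G -> p != q -> exists w, adj p w.
Proof.
move=> conn pq; case: (pickP (adj p)) => [w pw|none]; first by exists w.
have : q \in [set p].
  apply: (connected_closed conn (set11 p)) => y z yz /set1P E.
  by rewrite E none in yz.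
by rewrite inE eq_sym (negPf pq).
Qed.

(** Every edge meets [p], so the recurrence at [p] reads 3 = 1 + deg [p]; connectedness excludes
    vertices other than [p] and its two neighbours. *)
Lemma nmatch_star p : connected G -> nmatch [set: G] = 3 ->
    nmatch ([set: G] :\ p) = 1 ->
  exists u v, [/\ uniq [:: p; u; v], forall x, x \in [:: p; u; v], adj p u, adj p v
    & adj u v = false].
Proof.
move=> conn T3 T1; have/eqP/nmatch_eq1P free := T1.
have adjp x y : adj x y -> x = p \/ y = p.
  case: (x =P p) => [|/eqP xp]; first by left.
  by case: (y =P p) => [|/eqP yp]; [right | rewrite free ?inE ?xp ?yp].
have card_nb : #|[pred w | adj p w]| = 2.
  apply: (@addnI 1); rewrite [RHS](esym T3) (nmatchD1 (in_setT p)) T1.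
  rewrite -sum1_card; congr (_ + _); apply: eq_big => w; first by rewrite !inE.
  move=> _; apply/esym/eqP/nmatch_eq1P => x y xD yD; apply: free.
    by move: xD; rewrite !inE => /andP[].
  by move: yD; rewrite !inE => /andP[].
have [u [v [uv nb]]] : exists u v, u != v /\ forall w, adj p w = (w == u) || (w == v).
  have /cards2P[u [v [uv E]]] : #|[set w | adj p w]| == 2 by rewrite cardsE card_nb.
  by exists u, v; split=> // w; move/setP/(_ w): E; rewrite !inE.
have pu : adj p u by rewrite nb eqxx.
have pv : adj p v by rewrite nb eqxx orbT.
have neq w : adj p w -> p != w by apply: contraTneq => <-; rewrite adj_irrefl.
exists u, v; split=> //; first by rewrite /= !inE negb_or uv !neq.
  have in3 : p \in [set x in [:: p; u; v]] by rewrite !inE eqxx.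
  move=> x; suff : x \in [set x in [:: p; u; v]] by rewrite inE.
  apply: (connected_closed conn in3) => y z yz; rewrite !inE.
  case: (adjp _ _ yz) => [E _|->]; last by rewrite eqxx.
  by rewrite E in yz; rewrite -nb yz orbT.
by apply: free; rewrite !inE andbT eq_sym neq.
Qed.

(** Otherwise $Z(G-p) = Z(G-p-q) = 2$, so [p] is the only neighbour of [q], and the recurrence at
    [q] gives $Z(G) = 4 + 2 = 6$. *)
Lemma nmatchD1_gt2 p q : connected G -> p != q ->
    nmatch ([set: G] :\ p :\ q) = 2 ->
    nmatch ([set: G] :\ p) + nmatch ([set: G] :\ q) = 6 -> nmatch [set: G] <= 5 ->
  2 < nmatch ([set: G] :\ p).
Proof.
move=> conn pq T2 T6 T5; have := nmatchD1_le ([set: G] :\ p) q; rewrite T2.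
rewrite leq_eqVlt => /orP[/eqP E|//].
have qD : q \in [set: G] :\ p by rewrite !inE eq_sym pq.
have [|w qw] := @connected_neighbor q p conn; first by rewrite eq_sym.
have wp : w = p.
  apply/eqP/negPn/negP => wp; move: E; rewrite (nmatchD1 qD) T2 (bigD1 w) /=.
    by have := nmatch_gt0 ([set: G] :\ p :\ q :\ w); lia.
  by rewrite !inE wp.
have := T5; rewrite (nmatchD1 (in_setT q)) (bigD1 w) /=; last by rewrite inE.
by rewrite wp setD11C T2; lia.
Qed.

(** Both deletions have value 3, so $G-p-q$ has a single edge and each of [p], [q] is attached to
    one of its ends. The same end gives a star with 4 matchings, opposite ends a path with 5. *)
Lemma nmatch_two_pendants p q : connected G -> p != q ->
    nmatch ([set: G] :\ p :\ q) = 2 ->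
    nmatch ([set: G] :\ p) + nmatch ([set: G] :\ q) = 6 -> nmatch [set: G] <= 5 ->
  exists u v, [/\ uniq [:: p; q; u; v], forall x, x \in [:: p; q; u; v], adj u v,
      [/\ adj p u, adj p v = false & adj p q = false]
    & [/\ nmatch [set: G] = 4, adj q u & adj q v = false] \/
      [/\ nmatch [set: G] = 5, adj q v & adj q u = false]].
Proof.
move=> conn pq T2 T6 T5; have qp : q != p by rewrite eq_sym.
have T2' : nmatch ([set: G] :\ q :\ p) = 2 by rewrite setD11C.
have T3 : nmatch ([set: G] :\ p) = 3 /\ nmatch ([set: G] :\ q) = 3.
  have := nmatchD1_gt2 conn pq T2 T6 T5.
  have := nmatchD1_gt2 conn qp T2'; rewrite addnC => /(_ T6 T5); lia.
case: T3 => Tp Tq.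
have [a [b [aD bD ab edge]]] := nmatch_eq2 T2.
have [||q' [q'D qq' Tq' nbq]] := @nmatch_pendant ([set: G] :\ p) q.
- by rewrite !inE qp.
- by rewrite Tp T2.
have [||p' [p'D pp' Tp' nbp]] := @nmatch_pendant ([set: G] :\ q) p.
- by rewrite !inE pq.
- by rewrite Tq T2'.
(* Deleting the neighbour of [p] or of [q] destroys the edge [ab], so that neighbour is one of its
   ends. *)
have end_ab w : nmatch ([set: G] :\ p :\ q :\ w) = 1 -> w = a \/ w = b.
  move/eqP/nmatch_eq1P/(_ a b); rewrite !in_setD1 in aD bD *; rewrite ab.
  case: (a =P w) => [->|_]; first by left.
  case: (b =P w) => [->|_]; first by right.
  by rewrite aD bD => /(_ isT isT).
have Tp'' : nmatch ([set: G] :\ p :\ q :\ p') = 1 by rewrite (setD11C _ p).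
(* The ends are renamed so that [u] is the one adjacent to [p]. *)
have [u [v [uD vD uv {}edge Ep']]] : exists u v, [/\ u \in [set: G] :\ p :\ q,
    v \in [set: G] :\ p :\ q, adj u v,
    forall x y, x \in [set: G] :\ p :\ q -> y \in [set: G] :\ p :\ q -> adj x y ->
      x = u /\ y = v \/ x = v /\ y = u & p' = u].
  case: (end_ab _ Tp'') => E; [exists a, b | exists b, a]; split=> //.
    by rewrite adj_sym.
  by move=> x y xD yD xy; case: (edge x y xD yD xy); [right|left].
have Eq' : q' = u \/ q' = v.
  case: (end_ab _ Tq') => ->; case: (edge a b aD bD ab); tauto.
subst p'; move: uD vD; rewrite !inE !andbT => /andP[uq up] /andP[vq vp].
have uv' : u != v by apply: contraTneq uv => ->; rewrite adj_irrefl.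
(* Otherwise the recurrence at [p] has terms 3, 2 (from [q]) and at least 1 (from [u]), exceeding
   5. *)
have npq : adj p q = false.
  apply/negP => apq; move: T5; rewrite (nmatchD1 (in_setT p)).
  rewrite (bigD1 q) ?inE //= (bigD1 u) /= ?inE ?pp' ?uq //.
  rewrite Tp T2; have := nmatch_gt0 ([set: G] :\ p :\ u).
  by move: (nmatch _) (\sum_(_ | _) _) => k S; clear; lia.
have adjp x : adj p x = (x == u).
  apply/idP/eqP => [px|-> //]; apply: nbp => //.
  by rewrite !inE andbT; apply: contraTneq px => ->; rewrite npq.
have adjq x : adj q x = (x == q').
  apply/idP/eqP => [qx|-> //]; apply: nbq => //.
  by rewrite !inE andbT; apply: contraTneq qx => ->; rewrite adj_sym npq.
exists u, v; split=> //.
- by rewrite /= !inE !negb_or pq uv' !(eq_sym p) !(eq_sym q) up vp uq vq.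
- move=> x; suff : x \in [set x in [:: p; q; u; v]] by rewrite inE.
  have in4 : p \in [set x in [:: p; q; u; v]] by rewrite !inE eqxx.
  apply: (connected_closed conn in4) => y z yz; rewrite !inE => yX.
  apply/negPn/negP; rewrite !negb_or => /and4P[zp zq zu zv].
  case: (y =P p) yz => [->|/eqP yp yz]; first by rewrite adjp (negPf zu).
  case: (y =P q) yz => [->|/eqP yq yz].
    by rewrite adjq; case: Eq' => ->; rewrite ?(negPf zu) ?(negPf zv).
  have [] := edge y z _ _ yz; rewrite ?inE ?yp ?yq ?zp ?zq //.
    by case=> _ E; rewrite E eqxx in zv.
  by case=> _ E; rewrite E eqxx in zu.
- by rewrite !adjp eqxx eq_sym (negPf uv') // eq_sym (negPf uq).
(* $Z(G) = Z(G-p) + Z(G-p-u)$; the last term is 1, plus 1 if [q] keeps its neighbour after [u] is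
   deleted. *)
have Tval : nmatch [set: G] = 4 + (q' != u).
  rewrite (nmatchD1 (in_setT p)) (big_pred1 u) => [|w]; last by rewrite !inE adjp.
  rewrite Tp (@nmatchD1 _ _ q); last by rewrite !inE qp eq_sym uq.
  rewrite setD11C Tp''; case: eqP => [E|/eqP q'u] /=.
    rewrite big_pred0 // => w; rewrite !inE adjq E; by case: eqP; rewrite ?andbF.
  rewrite (big_pred1 q') => [|w]; last first.
    rewrite !inE adjq; case: (w =P q') => [->|_]; last by rewrite andbF.
    by move: q'D; rewrite !inE q'u => /andP[->].
  suff -> : nmatch ([set: G] :\ p :\ q :\ u :\ q') = 1 by [].
  by apply/eqP; rewrite eqn_leq nmatch_gt0 andbT -[leqRHS]Tp'' nmatchD1_le.
rewrite Tval !adjq; case: Eq' => ->; [left|right]; rewrite eqxx ?(negPf uv') eq_sym ?uv' //.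
by rewrite (negPf uv').
Qed.

End SmallGraphs.

(** * The three quadratic forms *)

Lemma P2_succ n : 1 < n -> P2 n.+1 n.
Proof.
by move=> n1; split=> //; [apply: ltnW|apply: coprimeSn|rewrite /=; case: odd|lia].
Qed.

Section PythagoreanForms.
Variables (cA bA aA cB bB aB cC bC aC : nat).
Hypothesis represents : forall m n, P2 m n -> exists x y, [/\ 0 < y,
  m ^ 2 - n ^ 2 = y ^ 2 * cA + x * y * bA + x ^ 2 * aA,
  2 * m * n = y ^ 2 * cB + x * y * bB + x ^ 2 * aB
  & m ^ 2 + n ^ 2 = y ^ 2 * cC + x * y * bC + x ^ 2 * aC].

(* Along the pairs [(n.+1, n)] the first form grows linearly in [n] and the
   third one quadratically, which a positive definite first form forbids. *)
Lemma form_quad_coef_eq0 : 0 < cA -> aA = 0.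
Proof.
move=> cA_gt0; case: (posnP aA) => // aA_gt0.
(* The third form is at most $K(x^2+y^2)$, and with [aA] positive the first is at least $x^2+y^2$.
   At $n = K+2$ this would give $(n+1)^2 + n^2 \le K(2n+1)$, which is false. *)
pose K := aC + bC + cC.
have [x [y [y_gt0 EA _ EC]]] := represents (P2_succ (isT : 1 < K.+2)).
have xy : x ^ 2 + y ^ 2 <= 2 * K.+2 + 1 by nia.
have : K.+3 ^ 2 + K.+2 ^ 2 <= K * (x ^ 2 + y ^ 2).
  rewrite EC /K !mulnDl.
  have : x * y <= x ^ 2 + y ^ 2 by nia.
  nia.
nia.
Qed.

(* The values 5, 7 and 11 taken at (3,2), (4,3) and (6,5) are primes, so that
   [y = 1] there; the value 33 at (7,4) then excludes [cA = 5]. *)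
Lemma form_coefs s : 0 < cA -> 0 < cB -> 0 < s -> bA = 2 * s ->
  [/\ s = 1, cA = 3, [/\ cB = 4, bB = 6 & aB = 2] & [/\ cC = 5, bC = 6 & aC = 2]].
Proof.
move=> cA_gt0 cB_gt0 s_gt0 bAE; have aA0 := form_quad_coef_eq0 cA_gt0.
have prime_value N x y : N \in [:: 5; 7; 11] -> 0 < y ->
    N = y ^ 2 * cA + x * y * bA + x ^ 2 * aA -> y = 1 /\ cA + 2 * s * x = N.
  move=> N_small y_gt0; rewrite aA0 muln0 addn0 bAE => EN.
  have {EN} EN : N = y * (y * cA + 2 * s * x) by nia.
  (* Since $y^2 \le N \le 11$, only 1, 2 and 3 remain, and neither 2 nor 3 divides 5, 7 or 11. *)
  have y3 : y <= 3 by move: N_small; rewrite !inE => /or3P[]/eqP; nia.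
  move: N_small; rewrite !inE => /or3P[]/eqP;
    by move: y y_gt0 y3 EN => [|[|[|[|]]]] //; lia.
have [x2 [y2 [y_gt0 EA2 EB2 EC2]]] := represents (P2_succ (isT : 1 < 2)).
have [//|? E2] := prime_value 5 x2 y2 isT y_gt0; subst y2.
have [x3 [y3 [{}y_gt0 EA3 EB3 EC3]]] := represents (P2_succ (isT : 1 < 3)).
have [//|? E3] := prime_value 7 x3 y3 isT y_gt0; subst y3.
have [x5 [y5 [{}y_gt0 EA5 EB5 EC5]]] := represents (P2_succ (isT : 1 < 5)).
have [//|? E5] := prime_value 11 x5 y5 isT y_gt0; subst y5.
(* Subtracting the equations for 5 and 7 gives $2s(x_3 - x_2) = 2$. *)
have s1 : s = 1.
  have : 2 * s * (x3 - x2) = 2 by rewrite mulnBr; lia.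
  have : x2 < x3 by nia.
  nia.
subst s; have x3E : x3 = x2 + 1 by lia.
have x5E : x5 = x2 + 3 by lia.
have x2_le2 : x2 <= 2 by lia.
have [x7 [y7 [{}y_gt0 EA7 EB7 EC7]]] : exists x y, [/\ 0 < y,
  7 ^ 2 - 4 ^ 2 = y ^ 2 * cA + x * y * bA + x ^ 2 * aA,
  2 * 7 * 4 = y ^ 2 * cB + x * y * bB + x ^ 2 * aB
  & 7 ^ 2 + 4 ^ 2 = y ^ 2 * cC + x * y * bC + x ^ 2 * aC] by exact: represents.
subst x3 x5; move: x2_le2 E2 EA2 EB2 EC2 EB3 EC3 EB5 EC5.
case: x2 EA3 EA5 E3 E5 => [|[|[|]]] // *.
(* For $x_2 = 0$ the second form is $12y^2 + 10xy + 2x^2$. At (7,4), $33 = y(5y+2x)$ forces $y = 1$,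
   $x = 14$, where that form exceeds 56. *)
- have cA5 : cA = 5 by lia.
  have y2 : y7 <= 2 by nia.
  have aB2 : aB = 2 by lia.
  have bB2 : bB = 10 by lia.
  have cB2 : cB = 12 by lia.
  move: y7 y_gt0 y2 EA7 EB7 {EC7} => [|[|[|]]] //; rewrite aA0 bAE cA5 aB2 bB2 cB2; nia.
(* For $x_2 = 1$ the arguments are $x = 1, 2, 4$ with $y = 1$, and three values determine each
   form. *)
- by split=> //; first lia; split; lia.
(* For $x_2 = 2$ the second form would have [cB = 0]. *)
- lia.
Qed.

End PythagoreanForms.

(** * Isomorphisms with caterpillars *)

(** This allows the map to be given explicitly on the caterpillar side; its inverse is obtained by
    choice. *)
Lemma bipointed_iso_inv (S T : bipointed_graph) (f : T -> S) :
    injective f -> (forall s, exists t, f t = s) ->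
    (forall x y, adj (f x) (f y) = adj x y) ->
    f (lbase T) = lbase S -> f (rbase T) = rbase S ->
  bipointed_iso S T.
Proof.
move=> fI fS fh fl fr.
have fS' s : exists t, f t == s by have [t <-] := fS s; exists t.
pose g s := xchoose (fS' s).
have gK : cancel g f by move=> s; apply/eqP/(xchooseP (fS' s)).
have fK : cancel f g by move=> t; apply: fI; rewrite gK.
exists g; split; [split; first by exists f|by rewrite -fl fK|by rewrite -fr fK].
by move=> x y; rewrite -fh !gK.
Qed.

Lemma cat_vertex_inj (a : seq nat) (c c' : cat_vertex a) :
  tag c = tag c' :> nat -> tagged c = tagged c' :> nat -> c = c'.
Proof.
case: c c' => [i j] [i' j'] /= /val_inj E; case: i' / E j' => j' /val_inj.
by move=> ->.
Qed.

Section CaterpillarIso.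
Variables (S : bipointed_graph) (a : seq nat) (a_gt0 : all (leq 1) a).
Variables (i j : 'I_(size a)) (rows : seq (seq S)).

Let f (c : caterpillar a) : S := nth (lbase S) (nth [::] rows (tag c)) (tagged c).

(* [rows] lists, leg by leg, the vertices of [S] matching those of the
   caterpillar. *)
Lemma caterpillar_iso :
    shape rows = a -> uniq (flatten rows) -> (forall s, s \in flatten rows) ->
    (forall c c' : caterpillar a, adj (f c) (f c') = adj c c') ->
    head (lbase S) (nth [::] rows i) = lbase S ->
    head (lbase S) (nth [::] rows j) = rbase S ->
  bipointed_iso S (dotted_caterpillar a_gt0 i j).
Proof.
move=> sh un all_in hom hl hr.
have rows_lt (c : cat_vertex a) : tagged c < nth 0 (shape rows) (tag c).
  by rewrite sh ltn_ord.
have nth_shape k : nth 0 (shape rows) k = size (nth [::] rows k).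
  by case: (ltnP k (size rows)) => k_lt;
    [rewrite (nth_map [::]) | rewrite !nth_default ?size_map].
(* Positions in the flattened list turn injectivity of [f] into uniqueness of its entries. *)
pose idx (c : cat_vertex a) := flatten_index (shape rows) (tag c) (tagged c).
have fE c : f c = nth (lbase S) (flatten rows) (idx c).
  by rewrite nth_flatten flatten_indexKl // flatten_indexKr.
apply: (@bipointed_iso_inv _ (dotted_caterpillar a_gt0 i j) f) => //.
- move=> c c'; rewrite !fE => /eqP.
  rewrite nth_uniq ?size_flatten ?flatten_indexP // => /eqP E.
  apply: cat_vertex_inj.
    by rewrite -[LHS](flatten_indexKl (rows_lt c)) -/(idx c) E flatten_indexKl.
  by rewrite -[LHS](flatten_indexKr (rows_lt c)) -/(idx c) E flatten_indexKr.
- move=> s; have /flattenP[row] := all_in s.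
  move=> /(nthP [::])[k k_lt <-] /(nthP (lbase S))[l l_lt <-].
  have k_lt' : k < size a by rewrite -sh size_map.
  have l_lt' : l < nth 0 a (Ordinal k_lt').
    by rewrite /= -[X in nth 0 X]sh nth_shape.
  by exists (Tagged (fun i : 'I_(size a) => 'I_(nth 0 a i)) (Ordinal l_lt')).
Qed.

End CaterpillarIso.

Lemma cat3_iso (S : bipointed_graph) u v : lbase S = rbase S ->
    uniq [:: lbase S; u; v] -> (forall x, x \in [:: lbase S; u; v]) ->
    adj (lbase S) u -> adj (lbase S) v -> adj u v = false ->
  bipointed_iso S (@dotted_caterpillar [:: 3] isT ord0 ord0).
Proof.
move=> lr un all_in lu lv uv.
apply: (@caterpillar_iso _ _ _ _ _ [:: [:: lbase S; u; v]]) => //.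
case=> [[[|//] ?] [[|[|[|//]]] ?]] [[[|//] ?] [[|[|[|//]]] ?]];
  by rewrite /= ?adj_irrefl // adj_sym.
Qed.

Lemma cat121_iso (S : bipointed_graph) u v (l := lbase S) (r := rbase S) :
    uniq [:: l; r; u; v] -> (forall x, x \in [:: l; r; u; v]) ->
    adj u v -> adj l u -> adj l v = false -> adj l r = false ->
    adj r u -> adj r v = false ->
  bipointed_iso S (@dotted_caterpillar [:: 1; 2; 1] isT ord0 ord_max).
Proof.
move=> un all_in uv lu lv lr ru rv.
have perm : perm_eq [:: l; u; v; r] [:: l; r; u; v].
  by rewrite perm_cons; apply/permPl/(perm_catC [:: u; v] [:: r]).
apply: (@caterpillar_iso _ _ _ _ _ [:: [:: l]; [:: u; v]; [:: r]]) => //.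
- by rewrite (perm_uniq perm).
- by move=> x; rewrite (perm_mem perm).
case=> [[[|[|[|//]]] ?] [[|[|//]] ?]] //= [[[|[|[|//]]] ?] [[|[|//]] ?]];
  by rewrite /= ?adj_irrefl // adj_sym.
Qed.

Lemma cat1111_iso (S : bipointed_graph) u v (l := lbase S) (r := rbase S) :
    uniq [:: l; r; u; v] -> (forall x, x \in [:: l; r; u; v]) ->
    adj u v -> adj l u -> adj l v = false -> adj l r = false ->
    adj r v -> adj r u = false ->
  bipointed_iso S (@dotted_caterpillar [:: 1; 1; 1; 1] isT ord0 ord_max).
Proof.
move=> un all_in uv lu lv lr rv ru.
have perm : perm_eq [:: l; u; v; r] [:: l; r; u; v].
  by rewrite perm_cons; apply/permPl/(perm_catC [:: u; v] [:: r]).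
apply: (@caterpillar_iso _ _ _ _ _ [:: [:: l]; [:: u]; [:: v]; [:: r]]) => //.
- by rewrite (perm_uniq perm).
- by move=> x; rewrite (perm_mem perm).
case=> [[[|[|[|[|//]]]] ?] [[|//] ?]] [[[|[|[|[|//]]]] ?] [[|//] ?]];
  by rewrite /= ?adj_irrefl // adj_sym.
Qed.

(** * Identification of the three kernels *)

Theorem theorem3p4 (A B C : nat -> nat -> graph) (A2 B2 C2 : bipointed_graph)
  (conn : forall m n, P2 m n ->
     [/\ connected (A m n), connected (B m n) & connected (C m n)])
  (hosoyaABC : forall m n, P2 m n ->
     [/\ hosoya (A m n) = m ^ 2 - n ^ 2,
         hosoya (B m n) = 2 * m * n
       & hosoya (C m n) = m ^ 2 + n ^ 2])
  (kernel : common_symmetric_kernel A B C A2 B2 C2) :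
  [/\ bipointed_iso A2 (@dotted_caterpillar [:: 3] isT ord0 ord0),
      bipointed_iso B2 (@dotted_caterpillar [:: 1; 2; 1] isT ord0 ord_max)
    & bipointed_iso C2
        (@dotted_caterpillar [:: 1; 1; 1; 1] isT ord0 ord_max)].
Proof.
have [connA2 connB2 connC2] : [/\ connected A2, connected B2 & connected C2].
  (* A single member of the family suffices for connectedness. *)
  have P32 : P2 3 2 by apply: P2_succ.
  have [cA cB cC] := conn 3 2 P32; have [G [isoA isoB isoC]] := kernel 3 2 P32.
  by split; [apply: connected_kernel isoA cA | apply: connected_kernel isoB cB
    | apply: connected_kernel isoC cC].
pose lin_coef (S : bipointed_graph) :=
  nmatch ([set: S] :\ lbase S) + nmatch ([set: S] :\ rbase S).
have forms m n : P2 m n -> exists x y, [/\ 0 < y,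
    m ^ 2 - n ^ 2 = y ^ 2 * nmatch [set: A2] + x * y * lin_coef A2
      + x ^ 2 * quad_coef A2,
    2 * m * n = y ^ 2 * nmatch [set: B2] + x * y * lin_coef B2
      + x ^ 2 * quad_coef B2
  & m ^ 2 + n ^ 2 = y ^ 2 * nmatch [set: C2] + x * y * lin_coef C2
      + x ^ 2 * quad_coef C2].
  move=> Pmn; have [hA hB hC] := hosoyaABC m n Pmn.
  have [G [isoA isoB isoC]] := kernel m n Pmn.
  exists (base_matched G), (base_free G); rewrite -hA -hB -hC.
  rewrite (hosoya_iso isoA) (hosoya_iso isoB) (hosoya_iso isoC).
  by split; [apply: nmatch_gt0 | apply: hosoya_glue..].
have posA := nmatch_gt0 [set: A2]; have posB := nmatch_gt0 [set: B2].
have qA0 := form_quad_coef_eq0 forms posA.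
have lrA : lbase A2 = rbase A2.
  (* With distinct base points the coefficient would be a number of matchings, hence positive. *)
  apply/eqP; move: qA0; rewrite /quad_coef; case: ifP => // _ q0.
  by have := nmatch_gt0 ([set: A2] :\ lbase A2 :\ rbase A2); rewrite q0.
have linA : lin_coef A2 = 2 * nmatch ([set: A2] :\ lbase A2).
  by rewrite /lin_coef -lrA addnn mul2n.
have [A1 A3 [B4 B6 B2'] [C5 C6 C2']] :=
  form_coefs forms posA posB (nmatch_gt0 _) linA.
have quad2 (S : bipointed_graph) : quad_coef S = 2 ->
    lbase S != rbase S /\ nmatch ([set: S] :\ lbase S :\ rbase S) = 2.
  by rewrite /quad_coef; case: ifP.
split.
- have [u [v [un all_in lu lv uv]]] := nmatch_star connA2 A3 A1.
  exact: cat3_iso un all_in lu lv uv.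
- have [lr T2] := quad2 _ B2'.
  (* The value 4 selects the star for [B2]; below, the value 5 selects the path for [C2]. *)
  have [|u [v [un all_in uv [lu lv nlr] [[_ ru rv]|[E]]]]] :=
      nmatch_two_pendants connB2 lr T2 B6; first by rewrite B4.
    exact: cat121_iso un all_in uv lu lv nlr ru rv.
  by rewrite B4 in E.
have [lr T2] := quad2 _ C2'.
have [|u [v [un all_in uv [lu lv nlr] [[E]|[_ rv ru]]]]] :=
    nmatch_two_pendants connC2 lr T2 C6; first by rewrite C5.
  by rewrite C5 in E.
exact: cat1111_iso un all_in uv lu lv nlr rv ru.
Qed.
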